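(* Let $Q>1$ be an even integer and let $f:\mathbb{Z}\to\{-1,1\}$ be a $Q$-periodic function such that $\sum_{k=0}^{Q-1}f(k)=0$. Let $\mathbf{H}_f$ be the oriented honeycomb lattice whose horizontal edges are oriented according to $f$: if $f(k)=1$ all horizontal edges with ordinate $k$ are right-directed, and if $f(k)=-1$ they are all left-directed; vertical edges are undirected. Then the simple random walk $(M_n)_{n\ge 0}$ on $\mathbf{H}_f$ is recurrent.
   Context: The honeycomb lattice is the graph with vertex set $\mathbb{Z}^2$ obtained from the nearest-neighbour square lattice by deleting, for all $j,k\in\mathbb{Z}$, the vertical edges between $(2j,2k)$ and $(2j,2k+1)$ and between $(2j+1,2k+1)$ and $(2j+1,2k+2)$. Thus all horizontal nearest-neighbour edges are kept, and the vertical edge between $(x,y)$ and $(x,y+1)$ is kept exactly when $x+y$ is odd. In a partially oriented version each horizontal edge is given one direction and vertical edges can be traversed both ways, so every vertex has exactly two outgoing edges (one horizontal, one vertical). The simple random walk $(M_n)_{n\ge0}$ starts at $(0,0)$ and at each step follows one of the two outgoing edges of its current vertex with probability $1/2$ each, independently of the past. The walk is transient if $\sum_{l\ge 0}\mathbb{P}_0(M_l=(0,0))<\infty$ and recurrent if this sum is infinite (equivalently, if the walk returns to the origin infinitely often almost surely). *)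

(* Defs.v *)
From HB Require Import structures.
From mathcomp Require Import all_boot all_order all_algebra.
From mathcomp Require Import all_classical all_reals all_analysis.

Set Implicit Arguments.
Unset Strict Implicit.
Unset Printing Implicit Defensive.

Import Order.TTheory GRing.Theory Num.Theory.

Local Open Scope classical_set_scope.
Local Open Scope ring_scope.

Definition vertex : Type := (int * int)%type.

Definition origin : vertex := (0, 0).

(* The square-lattice edge between (x, y) and (x, y + 1) is absent from the
   honeycomb lattice. *)
Definition deleted_vertical (x y : int) : Prop :=
  exists j k : int,
    (x = 2 * j /\ y = 2 * k) \/ (x = 2 * j + 1 /\ y = 2 * k + 1).

Definition vertical_edge (u v : vertex) : Prop :=
  u.1 = v.1 /\
  ((v.2 = u.2 + 1 /\ ~ deleted_vertical u.1 u.2) \/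
   (u.2 = v.2 + 1 /\ ~ deleted_vertical v.1 v.2)).

Definition horizontal_arc (f : int -> int) (u v : vertex) : Prop :=
  u.2 = v.2 /\
  ((f u.2 = 1 /\ v.1 = u.1 + 1) \/ (f u.2 = -1 /\ v.1 = u.1 - 1)).

Definition honeycomb_arc (f : int -> int) (u v : vertex) : Prop :=
  horizontal_arc f u v \/ vertical_edge u v.

(* When f takes its values in {-1, 1} every vertex has exactly two outgoing
   arcs, so this is a stochastic kernel. *)
Definition step_prob (R : realType) (f : int -> int) (u v : vertex) : R :=
  if `[< honeycomb_arc f u v >] then 2^-1 else 0.

(* The last clause is the Markov property written without conditioning, so that
   it also makes sense for histories of probability zero. *)
Definition simple_random_walk (R : realType) (d : measure_display)
    (T : measurableType d) (P : probability T R) (f : int -> int)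
    (M : nat -> T -> vertex) : Prop :=
  [/\ forall (n : nat) (v : vertex), measurable [set w | M n w = v],
      P [set w | M 0%N w = origin] = 1%E
    & forall (n : nat) (x : nat -> vertex),
        P [set w | forall i : nat, (i <= n.+1)%N -> M i w = x i] =
        (P [set w | forall i : nat, (i <= n)%N -> M i w = x i] *
         (step_prob R f (x n) (x n.+1))%:E)%E ].

Definition recurrent (R : realType) (d : measure_display)
    (T : measurableType d) (P : probability T R)
    (M : nat -> T -> vertex) : Prop :=
  (\sum_(0 <= l <oo) P [set w | M l w = origin] = +oo)%E.

(* Main.v *)
(* Let A be the transition operator of the walk on functions of Z^2; it
   preserves the counting measure.  If the return probabilities had a finite sum
   G, the truncated Green functions u = sum_(l < N) A^l delta_0 would satisfy
   <u, (I - A) u> <= u(0) <= G, so their Dirichlet energies E(u) would be bounded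
   uniformly in N.  A is not reversible, but its antisymmetric part lives on the
   rows with weights f(y) = F(y + 1) - F(y), where F is bounded because f is
   periodic with mean zero; Abel summation in y then compares adjacent rows and
   gives the sector condition |<phi, (I - A) u>| <= C (t E(u) + E(phi) / t).
   Test it against a logarithmic cutoff phi with phi(0) = 1 and tiny energy:
   1 = <phi, (I - A) u> + <phi, A^N delta_0> forces <phi, A^N delta_0> >= 1/2
   for all N, whereas bounded energy makes sum_N <phi, A^N delta_0> converge. *)
Require Import Defs.
From HB Require Import structures.
From mathcomp Require Import all_boot all_order all_algebra.
From mathcomp Require Import zify ring lra.
From mathcomp Require Import all_classical all_reals all_analysis.

Import Order.TTheory GRing.Theory Num.Theory.

Local Open Scope classical_set_scope.
Local Open Scope ring_scope.

Set Implicit Arguments.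
Unset Strict Implicit.
Unset Printing Implicit Defensive.

(** * Finitely supported functions on the square lattice *)

(** The interval [-K, K]; since [Negz i] is -(i + 1), K negative terms suffice. *)
Definition zrange (K : nat) : seq int :=
  map Posz (iota 0 K.+1) ++ map Negz (iota 0 K).

Section BoxSums.
Variable R : realFieldType.
Implicit Types (g h : int -> int -> R) (K n : nat).

Lemma mem_zrange K (x : int) : (x \in zrange K) = (`|x| <= K)%N.
Proof.
rewrite mem_cat; case: x => m.
  rewrite mem_map ?mem_iota => [|i j [] //].
  by rewrite add0n ltnS; apply/orb_idr => /mapP[].
rewrite orbC mem_map ?mem_iota => [|i j [] //].
by rewrite add0n NegzE abszN; apply/orb_idr => /mapP[].
Qed.

Lemma uniq_zrange K : uniq (zrange K).
Proof.
rewrite cat_uniq !map_inj_uniq ?iota_uniq ?andbT /=; last 2 first.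
- by move=> i j [].
- by move=> i j [].
by apply/hasPn => _ /mapP[j _ ->]; apply/negP => /mapP[].
Qed.

Lemma big_zrange K (g : int -> R) :
  \sum_(x <- zrange K) g x =
  \sum_(0 <= i < K.+1) g (Posz i) + \sum_(0 <= i < K) g (Negz i).
Proof. by rewrite big_cat !big_map /index_iota !subn0. Qed.

Lemma telescope_zrange K (g : int -> R) :
  \sum_(x <- zrange K) (g (x + 1) - g x) = g K.+1%:Z - g (- K%:Z).
Proof.
rewrite big_zrange.
rewrite (eq_big_nat _ _ (F2 := fun i => g i.+1%:Z - g i%:Z)); last first.
  by move=> i _; rewrite -addn1 PoszD.
rewrite telescope_sumr //.
rewrite (eq_big_nat _ _ (F2 := fun i => - (g (- i.+1%:Z) - g (- i%:Z)))); last first.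
  move=> i _; rewrite opprB NegzE.
  by congr (g _ - _); rewrite -addn1 PoszD opprD addrK.
by rewrite sumrN telescope_sumr // oppr0; ring.
Qed.

Lemma sum_nat_cutoff (q : nat -> R) k n :
  \sum_(0 <= i < k) (i < n)%:R * q i = \sum_(0 <= i < minn k n) q i.
Proof.
elim: k => [|k IH]; first by rewrite min0n !big_nil.
rewrite big_nat_recr //= IH; case: (boolP (k < n)%N) => kn.
  by rewrite (minn_idPl (ltnW kn)) (minn_idPl kn) big_nat_recr //= mul1r.
rewrite -leqNgt in kn.
by rewrite (minn_idPr kn) (minn_idPr (leqW kn)) mul0r addr0.
Qed.

Lemma sum_nat_cutoff_le (q : nat -> R) k n : (forall i, 0 <= q i) ->
  \sum_(0 <= i < k) (i < n)%:R * q i <= \sum_(0 <= i < n) q i.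
Proof.
move=> q0; rewrite sum_nat_cutoff.
rewrite (big_cat_nat (n := minn k n) (p := n)) ?geq_minr //=.
by rewrite lerDl sumr_ge0.
Qed.

Lemma sum_zrange_cutoff K n :
  \sum_(x <- zrange K) (`|x|%N <= n)%:R <= n.*2.+1%:R :> R.
Proof.
rewrite big_zrange -addnn -addSn natrD; apply: lerD.
  have := @sum_nat_cutoff_le (fun=> 1) K.+1 n.+1 (fun=> ler01).
  rewrite big_const_nat iter_addr_0 subn0.
  by under eq_bigr do rewrite mulr1 ltnS.
have := @sum_nat_cutoff_le (fun=> 1) K n (fun=> ler01).
rewrite big_const_nat iter_addr_0 subn0.
by under eq_bigr do rewrite mulr1.
Qed.

(** For finitely supported functions, and K far enough beyond the support to leave room for shifts,
    this is the sum over the whole lattice. *)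
Definition box_sum K g : R := \sum_(x <- zrange K) \sum_(y <- zrange K) g x y.

Lemma eq_box_sum K g h : (forall x y, g x y = h x y) -> box_sum K g = box_sum K h.
Proof. by move=> e; apply: eq_bigr => x _; apply: eq_bigr => y _. Qed.

Lemma ler_box_sum K g h : (forall x y, g x y <= h x y) ->
  box_sum K g <= box_sum K h.
Proof. by move=> e; apply: ler_sum => x _; apply: ler_sum => y _. Qed.

Lemma box_sum_ge0 K g : (forall x y, 0 <= g x y) -> 0 <= box_sum K g.
Proof. by move=> e; apply: sumr_ge0 => x _; apply: sumr_ge0 => y _. Qed.

Lemma box_sumD K g h :
  box_sum K (fun x y => g x y + h x y) = box_sum K g + box_sum K h.
Proof. by rewrite -big_split; apply: eq_bigr => x _; rewrite -big_split. Qed.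

Lemma box_sumZ K (a : R) g : box_sum K (fun x y => a * g x y) = a * box_sum K g.
Proof. by rewrite mulr_sumr; apply: eq_bigr => x _; rewrite mulr_sumr. Qed.

Lemma box_sumB K g h :
  box_sum K (fun x y => g x y - h x y) = box_sum K g - box_sum K h.
Proof.
rewrite -[- box_sum K h]mulN1r -box_sumZ -box_sumD.
by apply: eq_box_sum => x y; rewrite mulN1r.
Qed.

Lemma box_sum_sum K (I : Type) (r : seq I) (g : I -> int -> int -> R) :
  box_sum K (fun x y => \sum_(i <- r) g i x y) = \sum_(i <- r) box_sum K (g i).
Proof.
rewrite exchange_big; apply: eq_bigr => x _.
by rewrite exchange_big.
Qed.

Lemma box_sum_le_term K g x y : (forall x y, 0 <= g x y) ->
  (`|x| <= K)%N -> (`|y| <= K)%N -> g x y <= box_sum K g.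
Proof.
move=> g0 xK yK; rewrite /box_sum (bigD1_seq x) ?mem_zrange ?uniq_zrange //=.
rewrite (bigD1_seq y) ?mem_zrange ?uniq_zrange //= -addrA lerDl.
by rewrite addr_ge0 // sumr_ge0 // => i _; rewrite sumr_ge0.
Qed.

Lemma box_sum_telescope1 K g :
  (forall y, g K.+1%:Z y = 0) -> (forall y, g (- K%:Z) y = 0) ->
  box_sum K (fun x y => g (x + 1) y - g x y) = 0.
Proof.
move=> g1 g2; rewrite /box_sum exchange_big /=; apply: big1 => y _.
by rewrite (telescope_zrange K (fun x => g x y)) g1 g2 subr0.
Qed.

Lemma box_sum_telescope2 K g :
  (forall x, g x K.+1%:Z = 0) -> (forall x, g x (- K%:Z) = 0) ->
  box_sum K (fun x y => g x (y + 1) - g x y) = 0.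
Proof.
move=> g1 g2; apply: big1 => x _.
by rewrite (telescope_zrange K (g x)) g1 g2 subr0.
Qed.

Definition supported n g : Prop :=
  forall x y, (n < `|x|)%N || (n < `|y|)%N -> g x y = 0.

Lemma supportedW n m g : (n <= m)%N -> supported n g -> supported m g.
Proof. by move=> nm s x y h; apply: s; lia. Qed.

Lemma box_sum_shift1 K n g : supported n g -> (n < K)%N ->
  box_sum K (fun x y => g (x + 1) y) = box_sum K g.
Proof.
move=> sg nK; apply/eqP; rewrite -subr_eq0 -box_sumB; apply/eqP.
by apply: box_sum_telescope1 => y; apply: sg; lia.
Qed.

Lemma box_sum_shift2 K n g : supported n g -> (n < K)%N ->
  box_sum K (fun x y => g x (y + 1)) = box_sum K g.
Proof.
move=> sg nK; apply/eqP; rewrite -subr_eq0 -box_sumB; apply/eqP.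
by apply: box_sum_telescope2 => y; apply: sg; lia.
Qed.

Lemma box_sum_shiftN1 K n g : supported n g -> (n.+1 < K)%N ->
  box_sum K (fun x y => g (x - 1) y) = box_sum K g.
Proof.
move=> sg nK; rewrite -(@box_sum_shift1 K n.+1 (fun x y => g (x - 1) y)) //.
  by apply: eq_box_sum => x y; rewrite addrK.
by move=> x y h; apply: sg; lia.
Qed.

Definition delta0 (x y : int) : R := ((x == 0) && (y == 0))%:R.

Lemma box_sum_delta0 K g : box_sum K (fun x y => g x y * delta0 x y) = g 0 0.
Proof.
rewrite /box_sum (bigD1_seq 0) ?mem_zrange ?uniq_zrange //=.
rewrite (bigD1_seq 0) ?mem_zrange ?uniq_zrange //= /delta0 !eqxx mulr1.
rewrite big1 => [|y /negPf ->]; last by rewrite andbF mulr0.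
rewrite big1 ?addr0 // => x /negPf ->; rewrite big1 // => y _.
by rewrite mulr0.
Qed.

Definition d1 g (x y : int) : R := g (x + 1) y - g x y.
Definition d2 g (x y : int) : R := g x (y + 1) - g x y.

Lemma supported_d1 n g : supported n g -> supported n.+1 (d1 g).
Proof. by move=> s x y h; rewrite /d1 !s ?subr0 //; lia. Qed.
Lemma supported_d2 n g : supported n g -> supported n.+1 (d2 g).
Proof. by move=> s x y h; rewrite /d2 !s ?subr0 //; lia. Qed.

(** Dirichlet energy of the full square lattice, deleted vertical edges included, so that shifts and
    the cutoff can ignore parity. *)
Definition energy K g : R := box_sum K (fun x y => d1 g x y ^+ 2 + d2 g x y ^+ 2).

End BoxSums.

(** * The transition operator and its sector condition *)

Definition even_site (x y : int) : bool := (2 %| x + y)%Z.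

Lemma even_siteS1 x y : even_site (x + 1) y = ~~ even_site x y.
Proof. by rewrite /even_site; lia. Qed.

Lemma even_siteS2 x y : even_site x (y + 1) = ~~ even_site x y.
Proof. by rewrite /even_site; lia. Qed.

(** The vertical edge above (x, y) is kept exactly when x + y is odd, so an even site has its
    vertical neighbour below. *)
Definition vert_step (x y : int) : int :=
  if even_site x y then y - 1 else y + 1.

Section MarkovOperator.
Variables (R : realFieldType) (f : int -> int).
Hypothesis f_sign : forall k : int, f k = 1 \/ f k = -1.
Implicit Types (u phi : int -> int -> R) (K n : nat).

Definition avg u (x y : int) : R :=
  2^-1 * (u (x + f y) y + u x (vert_step x y)).

Lemma supported_avg n u : supported n u -> supported n.+1 (avg u).
Proof.
move=> s x y h; rewrite /avg /vert_step.
have fy := f_sign y.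
by rewrite !s; [rewrite addr0 mulr0|case: ifP => _; lia|lia].
Qed.

Definition odd_site (x y : int) : R := (~~ even_site x y)%:R.

Lemma odd_site_ge0 x y : 0 <= odd_site x y.
Proof. exact: ler0n. Qed.

Lemma odd_siteS1 x y : odd_site (x + 1) y = 1 - odd_site x y.
Proof. by rewrite /odd_site even_siteS1; case: even_site; rewrite /=; ring. Qed.

(** The orientation drops out on the diagonal: f(y) u(x,y) (u(x+1,y) - u(x-1,y)) is the x-increment
    of f(y) u(x,y) u(x-1,y). The energy of the honeycomb edges remains, each vertical edge being
    charged to its lower, odd endpoint. *)
Lemma box_sum_avg_energy K n u : supported n u -> (n.+2 < K)%N ->
  box_sum K (fun x y => u x y * (u x y - avg u x y)) =
  box_sum K (fun x y => 4^-1 * d1 u x y ^+ 2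
                        + 2^-1 * (odd_site x y * d2 u x y ^+ 2)).
Proof.
move=> su nK.
(* Boundary terms of the summations by parts along [x] and along [y]. *)
pose A x y := 4^-1 * u x y * (u x y - u (x - 1) y)
              + 4^-1 * (f y)%:~R * (u x y * u (x - 1) y).
pose B x y := 2^-1 * (1 - odd_site x y) * u x y * (u x y - u x (y - 1)).
have pw x y : u x y * (u x y - avg u x y) =
    (4^-1 * d1 u x y ^+ 2 + 2^-1 * (odd_site x y * d2 u x y ^+ 2))
    - (A (x + 1) y - A x y) - (B x (y + 1) - B x y).
  rewrite /A /B /avg /vert_step /odd_site even_siteS2 !addrK /d1 /d2.
  by case: (even_site x y); case: (f_sign y) => ->; rewrite /=; field.
rewrite (eq_box_sum _ pw) 2!box_sumB (box_sum_telescope1 (g := A))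
  ?(box_sum_telescope2 (g := B)) ?subr0 //.
- by move=> x; rewrite /B su ?mulr0 ?mul0r //; lia.
- by move=> x; rewrite /B su ?mulr0 ?mul0r //; lia.
- by move=> y; rewrite /A (su K.+1%:Z) ?mulr0 ?mul0r ?mulr0 ?addr0 //; lia.
- by move=> y; rewrite /A (su (- K%:Z)) ?mulr0 ?mul0r ?mulr0 ?addr0 //; lia.
Qed.

(** Abel summation in y replaces f by F times a y-difference of phi(x,y) (u(x+1,y) - u(x-1,y)).
    Where that difference falls on u, a summation by parts in x moves the x-difference to phi. Every
    term then pairs a gradient of phi with a gradient of u. *)
Lemma box_sum_avg_form K n (F : int -> R) u phi :
  (forall y : int, F (y + 1) = F y + (f y)%:~R) ->
  supported n u -> supported n phi -> (n.+2 < K)%N ->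
  box_sum K (fun x y => phi x y * (u x y - avg u x y)) =
  box_sum K (fun x y =>
    4^-1 * (d1 phi x y * d1 u x y)
    + 2^-1 * (odd_site x y * (d2 phi x y * d2 u x y))
    + 4^-1 * (F (y + 1) * (d2 phi x y * (d1 u x y + d1 u (x - 1) y)))
    - 4^-1 * (F (y + 1) *
        (d2 u x y * (d1 phi x (y + 1) + d1 phi (x - 1) (y + 1))))).
Proof.
move=> FS su sp nK.
pose w x y := d2 u x y.
(* [A] collects the boundary terms of the summations by parts in x, [B] those in y; both vanish at
   the ends of the box. *)
pose A x y := 4^-1 * phi x y * (u x y - u (x - 1) y)
  - 4^-1 * F (y + 1) * (phi (x - 1) (y + 1) * w x y + phi x (y + 1) * w (x - 1) y).
pose B x y := 2^-1 * (1 - odd_site x y) * phi x y * (u x y - u x (y - 1))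
  + 4^-1 * F y * (phi x y * (u (x + 1) y - u (x - 1) y)).
have pw x y : phi x y * (u x y - avg u x y) =
    (4^-1 * (d1 phi x y * d1 u x y)
    + 2^-1 * (odd_site x y * (d2 phi x y * d2 u x y))
    + 4^-1 * (F (y + 1) * (d2 phi x y * (d1 u x y + d1 u (x - 1) y)))
    - 4^-1 * (F (y + 1) *
        (d2 u x y * (d1 phi x (y + 1) + d1 phi (x - 1) (y + 1)))))
    - (A (x + 1) y - A x y) - (B x (y + 1) - B x y).
  rewrite /A /B /avg /w /vert_step /odd_site even_siteS2 FS /d1 /d2 !addrK.
  by case: (even_site x y); case: (f_sign y) => ->; rewrite /=; field.
rewrite (eq_box_sum _ pw) box_sumB box_sumB (box_sum_telescope1 (g := A))
  ?(box_sum_telescope2 (g := B)) ?subr0 //.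
- by move=> x; rewrite /B sp ?mulr0 ?mul0r ?mulr0 ?addr0 //; lia.
- by move=> x; rewrite /B sp ?mulr0 ?mul0r ?mulr0 ?addr0 //; lia.
- move=> y; rewrite /A !sp ?mulr0 ?mul0r ?mulr0 ?addr0 ?mulr0 ?subr0 //; lia.
- move=> y; rewrite /A !sp ?mulr0 ?mul0r ?mulr0 ?addr0 ?mulr0 ?subr0 //; lia.
Qed.

(* A missing vertical edge above an even site is bypassed by three edges of the
   honeycomb lattice. *)
Lemma energy_le_avg_energy K n u : supported n u -> (n.+3 < K)%N ->
  energy K u <= 28 * box_sum K (fun x y => u x y * (u x y - avg u x y)).
Proof.
move=> su nK; rewrite (box_sum_avg_energy su) ?(ltnW nK) //.
pose D x y := d1 u x y ^+ 2.
pose V x y := odd_site x y * d2 u x y ^+ 2.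
have sD : supported n.+1 D by move=> x y h; rewrite /D (supported_d1 su) ?expr0n.
have sV : supported n.+1 V
  by move=> x y h; rewrite /V (supported_d2 su) ?expr0n ?mulr0.
(* At an even site, (a + b - c)^2 <= 3 (a^2 + b^2 + c^2), together with a^2 itself, gives these
   weights. After shifting they total 7 D + 4 V, at most 28 (D / 4 + V / 2). *)
apply: (@le_trans _ _ (box_sum K
  (fun x y => 4 * D x y + 3 * D x (y + 1) + V x y + 3 * V (x + 1) y))).
  apply: ler_box_sum => x y; rewrite /V odd_siteS1 /D.
  have -> : d2 u x y = d1 u x y + d2 u (x + 1) y - d1 u x (y + 1).
    by rewrite /d1 /d2; ring.
  rewrite /odd_site; set a := d1 u x y; set b := d2 _ _ _; set c := d1 u x _.
  have h1 := sqr_ge0 (a - b); have h2 := sqr_ge0 (b + c); have h3 := sqr_ge0 (a + c).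
  have h4 := sqr_ge0 a; have h5 := sqr_ge0 c; have h6 := sqr_ge0 b.
  by case: even_site => /=; rewrite ?subr0 ?subrr ?mul0r ?mul1r ?mulr0; nra.
have V0 : 0 <= box_sum K V.
  by apply: box_sum_ge0 => x y; rewrite mulr_ge0 ?odd_site_ge0 ?sqr_ge0.
have D0 : 0 <= box_sum K D by apply: box_sum_ge0 => x y; exact: sqr_ge0.
rewrite !box_sumD !box_sumZ (box_sum_shift2 sD) ?(box_sum_shift1 sV); try lia.
by rewrite -/D -/V; lra.
Qed.

Lemma mulr_amgm (t p q : R) : 0 < t -> p * q <= 2^-1 * (t * p ^+ 2 + t^-1 * q ^+ 2).
Proof.
move=> t0; rewrite -subr_ge0.
have -> : 2^-1 * (t * p ^+ 2 + t^-1 * q ^+ 2) - p * q =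
    2^-1 * t * (p - t^-1 * q) ^+ 2.
  by field; rewrite gt_eqF.
by rewrite mulr_ge0 ?sqr_ge0 // mulr_ge0 ?ltW.
Qed.

Lemma mulr_amgm_bounded (C c t p q : R) : `|c| <= C -> 0 < t ->
  c * (p * q) <= C * (2^-1 * (t * p ^+ 2 + t^-1 * q ^+ 2)).
Proof.
move=> cC t0; apply: (le_trans (ler_norm _)); rewrite normrM.
apply: ler_pM => //; rewrite ler_norml lerNl -mulNr mulr_amgm // andbT.
by have := mulr_amgm (- p) q t0; rewrite sqrrN.
Qed.

(** The sector condition: each product of gradients is split by the mean inequality with weight t,
    and 1 <= C absorbs the terms without F. *)
Lemma box_sum_avg_form_le K n (F : int -> R) (C t : R) u phi :
  (forall y : int, F (y + 1) = F y + (f y)%:~R) ->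
  (forall y, `|F y| <= C) -> 1 <= C -> 0 < t ->
  supported n u -> supported n phi -> (n.+4 < K)%N ->
  box_sum K (fun x y => phi x y * (u x y - avg u x y)) <=
  C * (t * energy K u + t^-1 * energy K phi).
Proof.
move=> FS FC C1 t0 su sp nK.
rewrite (box_sum_avg_form FS su sp); last by lia.
have sq (g : int -> int -> R) m :
    supported m g -> supported m (fun x y => g x y ^+ 2).
  by move=> s x y h; rewrite s ?expr0n.
have s1u := sq _ _ (supported_d1 su); have s1p := sq _ _ (supported_d1 sp).
have s1p' : supported n.+2 (fun x y => d1 phi x (y + 1) ^+ 2).
  by move=> x y h; apply: s1p; lia.
(* The factor 1/8 is the coefficient 1/4 of the F-terms times the 1/2 of the mean inequality. *)
pose c1 := C * 8^-1; have V0 : 0 < t^-1 by rewrite invr_gt0.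
apply: (@le_trans _ _ (box_sum K (fun x y =>
  t * ((8^-1 + c1) * d1 u x y ^+ 2 + c1 * d1 u (x - 1) y ^+ 2
       + (4^-1 + 2 * c1) * d2 u x y ^+ 2)
  + t^-1 * (8^-1 * d1 phi x y ^+ 2 + (4^-1 + 2 * c1) * d2 phi x y ^+ 2
       + (c1 * d1 phi x (y + 1) ^+ 2 + c1 * d1 phi (x - 1) (y + 1) ^+ 2))))).
  apply: ler_box_sum => x y.
  set a := d1 phi x y; set b := d2 phi x y; set al := d1 u x y.
  set al' := d1 u (x - 1) y; set be := d2 u x y.
  set a1 := d1 phi x (y + 1); set a2 := d1 phi (x - 1) (y + 1).
  have h0 := mulr_amgm al a t0.
  have o1 : `|odd_site x y| <= 1.
    by rewrite /odd_site; case: even_site; rewrite ?normr0 ?normr1 ?ler01.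
  have h1 := mulr_amgm_bounded be b o1 t0.
  have h2 := mulr_amgm_bounded al b (FC (y + 1)) t0.
  have h3 := mulr_amgm_bounded al' b (FC (y + 1)) t0.
  have FN : `|- F (y + 1)| <= C by rewrite normrN.
  have h4 := mulr_amgm_bounded be a1 FN t0.
  have h5 := mulr_amgm_bounded be a2 FN t0.
  by move: h0 h1 h2 h3 h4 h5; rewrite /c1; lra.
rewrite /energy !(box_sumD, box_sumZ).
rewrite (box_sum_shiftN1 s1u) ?(box_sum_shiftN1 s1p') ?(box_sum_shift2 s1p); try lia.
set D1u := box_sum _ _; set D2u := box_sum _ _.
set D1p := box_sum _ _; set D2p := box_sum _ _.
have [] : 0 <= D1u /\ 0 <= D2u by split; apply: box_sum_ge0 => x y; exact: sqr_ge0.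
have [] : 0 <= D1p /\ 0 <= D2p by split; apply: box_sum_ge0 => x y; exact: sqr_ge0.
move=> p1 p2 u1 u2; rewrite [leRHS]mulrDr; apply: lerD; rewrite [leRHS]mulrCA.
  by rewrite ler_pM2l // /c1; nra.
by rewrite ler_pM2l // /c1; nra.
Qed.

End MarkovOperator.

(** * The logarithmic cutoff *)

Section LogCutoff.
Variable R : realFieldType.

Definition harmonic_sum (n : nat) : R := \sum_(0 <= k < n) k.+1%:R^-1.

(** Discrete analogue of 1 - log r / log n, equal to 0 for r >= n, where the sum is empty. *)
Definition radial_cutoff (n r : nat) : R :=
  (\sum_(r <= k < n) k.+1%:R^-1) / harmonic_sum n.

Definition cutoff (n : nat) (x y : int) : R :=
  radial_cutoff n (maxn `|x| `|y|).

Lemma harmonic_sum_ge0 n : 0 <= harmonic_sum n.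
Proof. by apply: sumr_ge0 => k _; rewrite invr_ge0. Qed.

Lemma radial_cutoffS n r :
  radial_cutoff n r - radial_cutoff n r.+1 =
  (r < n)%:R * (r.+1%:R^-1 / harmonic_sum n).
Proof.
rewrite /radial_cutoff -mulrBl mulrA; congr (_ / _).
case: (ltnP r n) => rn; first by rewrite [X in X - _]big_ltn // addrK mul1r.
by rewrite !big_geq ?subrr ?mul0r // ltnW.
Qed.

Lemma cutoffC n x y : cutoff n x y = cutoff n y x.
Proof. by rewrite /cutoff maxnC. Qed.

Lemma supported_cutoff n : supported n (cutoff n).
Proof.
move=> x y h; rewrite /cutoff /radial_cutoff big_geq ?mul0r //; lia.
Qed.

Lemma cutoff_ge0 n x y : 0 <= cutoff n x y.
Proof.
rewrite /cutoff /radial_cutoff mulr_ge0 ?invr_ge0 ?harmonic_sum_ge0 //.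
by apply: sumr_ge0 => k _; rewrite invr_ge0.
Qed.

Lemma cutoff_le1 n x y : cutoff n x y <= 1.
Proof.
(* For n = 0 the denominator is 0, and the convention that 0 has inverse 0 makes the cutoff 0. *)
have [H0|H0] := eqVneq (harmonic_sum n) 0.
  by rewrite /cutoff /radial_cutoff H0 invr0 mulr0.
rewrite /cutoff /radial_cutoff ler_pdivrMr ?lt_def ?H0 ?harmonic_sum_ge0 //.
rewrite mul1r; set r := maxn _ _; rewrite /harmonic_sum.
case: (leqP r n) => rn; last first.
  by rewrite big_geq ?harmonic_sum_ge0 // ltnW.
rewrite [leRHS](big_cat_nat (n := r)) //= lerDr.
by apply: sumr_ge0 => k _; rewrite invr_ge0.
Qed.

Lemma cutoff00 n : harmonic_sum n != 0 -> cutoff n 0 0 = 1.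
Proof. by move=> H0; rewrite /cutoff /radial_cutoff divff. Qed.

(* The cutoff varies along the horizontal edge from [(x, y)] to [(x + 1, y)]
   only if [|y|] is at most the distance of that edge to the vertical axis. *)
Lemma d1_cutoff_sqr n x y :
  let m := match x with Posz k => k | Negz k => k end in
  d1 (cutoff n) x y ^+ 2 =
  (m < n)%:R * (m.+1%:R^-1 / harmonic_sum n) ^+ 2 * (`|y| <= m)%:R.
Proof.
move=> m.
have <- : (radial_cutoff n m - radial_cutoff n m.+1) ^+ 2 * (`|y| <= m)%:R
   = (m < n)%:R * (m.+1%:R^-1 / harmonic_sum n) ^+ 2 * (`|y| <= m)%:R.
  rewrite radial_cutoffS; case: (m < n)%N; rewrite /= ?mul1r //.
  by rewrite !mul0r expr0n /= mul0r.
rewrite /d1 /cutoff {}/m; case: x => k.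
  rewrite -PoszD addn1 !absz_nat.
  have [yk|yk] := boolP (`|y| <= k)%N; last rewrite -ltnNge in yk.
    by rewrite (maxn_idPl yk) (maxn_idPl (leqW yk)) /= mulr1 -sqrrN opprB.
  by rewrite (maxn_idPr (ltnW yk)) (maxn_idPr yk) subrr expr0n /= mulr0.
have -> : Negz k + 1 = - k%:Z by lia.
rewrite NegzE !abszN !absz_nat.
have [yk|yk] := boolP (`|y| <= k)%N; last rewrite -ltnNge in yk.
  by rewrite (maxn_idPl yk) (maxn_idPl (leqW yk)) /= mulr1.
by rewrite (maxn_idPr (ltnW yk)) (maxn_idPr yk) subrr expr0n /= mulr0.
Qed.

(** At distance k from the vertical axis, at most 2k + 1 horizontal edges on each side carry a
    gradient of size 1 / ((k + 1) H), contributing at most 2 / ((k + 1) H^2). Summing over k < n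
    gives 2 / H per side; swapping the coordinates doubles the total 4 / H. *)
Lemma energy_cutoff_le K n : energy K (cutoff n) <= 8 / harmonic_sum n.
Proof.
set H := harmonic_sum n; have H0 : 0 <= H by exact: harmonic_sum_ge0.
have -> : energy K (cutoff n) = 2 * box_sum K (fun x y => d1 (cutoff n) x y ^+ 2).
  rewrite /energy box_sumD mulrDl mul1r; congr (_ + _).
  rewrite /box_sum exchange_big /=.
  apply: eq_bigr => x _; apply: eq_bigr => y _.
  by rewrite /d1 /d2 !(cutoffC n y).
suff : box_sum K (fun x y => d1 (cutoff n) x y ^+ 2) <= 4 / H by lra.
pose q (k : nat) : R := 2 * k.+1%:R^-1 / H ^+ 2.
have q0 k : 0 <= q k by rewrite !mulr_ge0 ?invr_ge0 ?exprn_ge0.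
have row (x : int) (k : nat) : (match x with Posz k => k | Negz k => k end) = k ->
    \sum_(y <- zrange K) d1 (cutoff n) x y ^+ 2 <= (k < n)%:R * q k.
  move=> xk.
  under eq_bigr do rewrite d1_cutoff_sqr xk.
  rewrite -mulr_sumr -mulrA ler_wpM2l //.
  apply: (@le_trans _ _ ((k.+1%:R^-1 / H) ^+ 2 * k.*2.+1%:R)).
    by rewrite ler_wpM2l ?sqr_ge0 // sum_zrange_cutoff.
  apply: (@le_trans _ _ ((k.+1%:R^-1 / H) ^+ 2 * (2 * k.+1%:R))).
    by rewrite ler_wpM2l ?sqr_ge0 // -natrM ler_nat; lia.
  suff -> : (k.+1%:R^-1 / H) ^+ 2 * (2 * k.+1%:R) = q k by [].
  have -> : (k.+1%:R^-1 / H) ^+ 2 * (2 * k.+1%:R)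
      = 2 * k.+1%:R^-1 * H^-1 ^+ 2 * (k.+1%:R^-1 * k.+1%:R) by ring.
  by rewrite mulVf ?pnatr_eq0 // mulr1 exprVn.
have qs : \sum_(0 <= k < n) q k = 2 / H.
  rewrite -mulr_suml -mulr_sumr -/(harmonic_sum n) -/H expr2.
  have [->|Hn0] := eqVneq H 0; first by rewrite mulr0 mul0r invr0 mulr0.
  by field.
rewrite /box_sum big_zrange.
have -> : 4 / H = 2 / H + 2 / H by lra.
rewrite -qs; apply: lerD.
  apply: le_trans (sum_nat_cutoff_le K.+1 n q0).
  by apply: ler_sum => k _; apply: row.
apply: le_trans (sum_nat_cutoff_le K n q0).
by apply: ler_sum => k _; apply: row.
Qed.

End LogCutoff.

(** * Green functions *)

(** The primitive is the sum of f over the integers from 0 below y mod Q. It is periodic, hence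
    bounded, and the zero sum of f makes it consistent when y passes to the next period. *)
Lemma bounded_primitive (R : realFieldType) (Q : nat) (f : int -> int) :
  (0 < Q)%N -> (forall k : int, f (k + Q%:Z) = f k) ->
  \sum_(0 <= k < Q) f k%:Z = 0 ->
  exists (F : int -> R) (C : R),
    [/\ forall y : int, F (y + 1) = F y + (f y)%:~R,
        forall y, `|F y| <= C & 1 <= C].
Proof.
move=> Q0 fQ f0.
have fQn (k : int) (m : nat) : f (k + (m * Q)%N%:Z) = f k.
  elim: m => [|m IH]; first by rewrite mul0n addr0.
  by rewrite mulSn addnC PoszD addrA fQ.
have fmod (y : int) : f (y %% Q)%Z = f y.
  have yE := divz_eq y Q; set r := (y %% Q)%Z in yE *.
  rewrite yE; case: (y %/ Q)%Z => m.
    by rewrite -PoszM addrC fQn.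
  by rewrite -[in RHS](fQn _ m.+1) NegzE PoszM; congr f; ring.
pose G (m : nat) : int := \sum_(0 <= k < m) f k%:Z.
pose F (y : int) : R := (G `|(y %% Q)%Z|%N)%:~R.
pose C : R := 1 + \sum_(0 <= k < Q) `|(f k%:Z)%:~R|.
have modQ (y : int) : exists2 r : nat, (r < Q)%N & (y %% Q)%Z = r.
  have r0 : 0 <= (y %% Q)%Z by rewrite modz_ge0; lia.
  have rQ : (y %% Q)%Z < Q by rewrite ltz_pmod; lia.
  by exists `|(y %% Q)%Z|%N; lia.
exists F, C; split.
- move=> y; rewrite /F -fmod -intrD; congr _%:~R; rewrite /G.
  have [r rQ yr] := modQ y.
  have yE : y + 1 = (y %/ Q)%Z * Q%:Z + r.+1%:Z.
    by rewrite {1}(divz_eq y Q) yr; lia.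
  rewrite yE yr absz_nat modzMDl; case: (ltnP r.+1 Q) => h.
    by rewrite modz_small; [rewrite absz_nat big_nat_recr|lia].
  have rS : r.+1 = Q by lia.
  by rewrite rS modzz big_geq // -[LHS]f0 -rS big_nat_recr.
- move=> y; rewrite /F /C /G; have [r rQ ->] := modQ y.
  rewrite absz_nat raddf_sum; apply: (le_trans (ler_norm_sum _ _ _)).
  rewrite [in leRHS](big_cat_nat (n := r)) ?(ltnW rQ) //=.
  by rewrite addrCA lerDl addr_ge0 // sumr_ge0.
- by rewrite lerDl sumr_ge0.
Qed.

Section GreenFunction.
Variables (R : realFieldType) (f : int -> int).
Hypothesis f_sign : forall k : int, f k = 1 \/ f k = -1.
Implicit Types (K n N l : nat).
Notation avg := (@avg R f).

(** A^l delta_0: the probability that a walk started at (x, y) is at the origin after l steps. *)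
Definition hit_prob l : int -> int -> R := iter l avg (@delta0 R).

Definition green N (x y : int) : R := \sum_(0 <= l < N) hit_prob l x y.

Lemma supported_hit_prob l : supported l (hit_prob l).
Proof.
elim: l => [|l IH]; last exact: supported_avg.
by move=> x y h; rewrite /= /delta0; case: eqP => [x0|]; case: eqP => // y0; lia.
Qed.

Lemma hit_prob_ge0 l x y : 0 <= hit_prob l x y.
Proof.
elim: l x y => [|l IH] x y; first exact: ler0n.
by rewrite /= /avg mulr_ge0 ?invr_ge0 // addr_ge0 ?IH.
Qed.

Lemma green_ge0 N x y : 0 <= green N x y.
Proof. by apply: sumr_ge0 => l _; exact: hit_prob_ge0. Qed.

Lemma supported_green N : supported N (green N).
Proof.
move=> x y h; rewrite /green big_nat; apply: big1 => l /andP[_ lN].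
by apply: supported_hit_prob; lia.
Qed.

(** Telescoping: (I - A) (I + A + ... + A^(N-1)) = I - A^N. *)
Lemma green_sub_avg N x y :
  green N x y - avg (green N) x y = delta0 R x y - hit_prob N x y.
Proof.
have tele := telescope_sumr (fun l => hit_prob l x y) (leq0n N).
rewrite -[RHS]opprB -tele -sumrN /avg /green -big_split mulr_sumr -sumrB.
by apply: eq_bigr => l _; rewrite opprB.
Qed.

(** For u = [green N] the form <u, (I - A) u> equals u(0) - <u, A^N delta_0>, and the subtracted
    term is nonnegative. *)
Lemma energy_green_le K N : (N.+3 < K)%N ->
  energy K (green N) <= 28 * green N 0 0.
Proof.
move=> NK; apply: (le_trans (energy_le_avg_energy f_sign (@supported_green N) NK)).
rewrite ler_pM2l //.
under eq_box_sum do rewrite green_sub_avg mulrBr.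
rewrite box_sumB box_sum_delta0 gerBl.
by apply: box_sum_ge0 => x y; rewrite mulr_ge0 ?green_ge0 ?hit_prob_ge0.
Qed.

(** The energy bounds every edge increment, so the Green function grows at most linearly along the
    vertical axis and then along a row. A bound at the origin thus controls it on the support of a
    cutoff, uniformly in N. *)
Lemma green_le N x y :
  green N x y <=
  green N 0 0 + (`|x| + `|y|)%N%:R * (1 + 28 * green N 0 0).
Proof.
set A := 1 + _.
(* Square roots are avoided: e^2 <= s implies |e| <= 1 + s. *)
have diff (e : R) : e ^+ 2 <= 28 * green N 0 0 -> `|e| <= A.
  rewrite -real_normK ?num_real // => h; rewrite /A.
  by have := sqr_ge0 (`|e| - 1); have := normr_ge0 e; nra.
have term (g : int -> int -> R) (x0 y0 : int) : supported N.+1 g ->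
    (forall x1 y1, g x1 y1 ^+ 2 <=
      d1 (green N) x1 y1 ^+ 2 + d2 (green N) x1 y1 ^+ 2) ->
    `|g x0 y0| <= A.
  move=> sg gE; have NK : (N.+3 < N.+4)%N by [].
  apply: diff; have [h|h] := boolP ((N.+1 < `|x0|) || (N.+1 < `|y0|))%N.
    by rewrite sg // expr0n mulr_ge0 // green_ge0.
  apply: (le_trans (gE x0 y0)); apply: le_trans (energy_green_le NK).
  apply: (box_sum_le_term (g := fun x y =>
    d1 (green N) x y ^+ 2 + d2 (green N) x y ^+ 2)); try lia.
  by move=> *; rewrite addr_ge0 ?sqr_ge0.
have t1 x0 y0 : `|green N (x0 + 1) y0 - green N x0 y0| <= A.
  apply: (term (d1 (green N))); first exact/supported_d1/supported_green.
  by move=> *; rewrite lerDl sqr_ge0.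
have t2 x0 y0 : `|green N x0 (y0 + 1) - green N x0 y0| <= A.
  apply: (term (d2 (green N))); first exact/supported_d2/supported_green.
  by move=> *; rewrite lerDr sqr_ge0.
have line (g : int -> R) : (forall x, `|g (x + 1) - g x| <= A) ->
    forall x, g x <= g 0 + `|x|%N%:R * A.
  move=> gA; case=> k.
    elim: k => [|k IH]; first by rewrite mul0r addr0.
    have := gA k%:Z; rewrite -PoszD addn1 ler_norml => /andP[_].
    by move: IH; rewrite !absz_nat -[k.+1%:R]natr1; lra.
  rewrite NegzE abszN absz_nat.
  have : g (- k%:Z) <= g 0 + k%:R * A -> g (- k.+1%:Z) <= g 0 + k.+1%:R * A.
    have := gA (- k.+1%:Z); have -> : - k.+1%:Z + 1 = - k%:Z by lia.
    by rewrite ler_norml -[k.+1%:R]natr1 => /andP[+ _]; lra.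
  apply; elim: k => [|k IH]; first by rewrite oppr0 mul0r addr0.
  have := gA (- k.+1%:Z); have -> : - k.+1%:Z + 1 = - k%:Z by lia.
  by move: IH; rewrite ler_norml -[k.+1%:R]natr1 => + /andP[+ _]; lra.
have := line _ (t1 ^~ y) x; have := line _ (t2 0) y.
by rewrite natrD; lra.
Qed.

End GreenFunction.

(** * Divergence of the Green function at the origin *)

Lemma harmonic_sum_unbounded (R : realType) (A : R) :
  exists n, A <= harmonic_sum R n.
Proof.
apply: contrapT => /forallNP hA; apply: (@dvg_harmonic R).
have -> : series (@harmonic R) = harmonic_sum R.
  by apply/funext => n; rewrite seriesEnat.
apply: nondecreasing_is_cvgn.
  apply/nondecreasing_seqP => n.
  by rewrite /harmonic_sum big_nat_recr //= lerDl invr_ge0.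
by exists A => _ [n _ <-]; rewrite leNgt; apply/negP => /ltW /hA.
Qed.

(** A bound G would force the pairing of the cutoff with [green N] to be at least N / 2 and yet
    bounded independently of N. *)
Lemma green_unbounded (R : realType) (f : int -> int) (F : int -> R) (C : R) :
  (forall k : int, f k = 1 \/ f k = -1) ->
  (forall y : int, F (y + 1) = F y + (f y)%:~R) ->
  (forall y, `|F y| <= C) -> 1 <= C ->
  forall G : R, exists N, G < green R f N 0 0.
Proof.
move=> f_sign FS FC C1 G; apply: contrapT => /forallNP gG.
have {}gG N : green R f N 0 0 <= G by rewrite leNgt; apply/negP/gG.
have G0 : 0 <= G by apply: le_trans (gG 0%N); exact: green_ge0.
have C0 : 0 < C by lra.
(* As 112 = 4 * 28, the energy bound 28 (G + 1) makes the Green part of the sector bound at most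
   1/4; G + 1 keeps the denominator positive. *)
have [t t0 tE] : exists2 t : R, 0 < t & 112 * C * (G + 1) * t = 1.
  have D0 : 0 < 112 * C * (G + 1) by rewrite !mulr_gt0 //; lra.
  by exists (112 * C * (G + 1))^-1; rewrite ?invr_gt0 // divff ?gt_eqF.
(* As 32 = 4 * 8, the cutoff, of energy at most 8 / H, also contributes at most 1/4. *)
have [n nH] := harmonic_sum_unbounded (32 * C * t^-1).
have H0 : 0 < harmonic_sum R n.
  by apply: lt_le_trans nH; rewrite mulr_gt0 ?invr_gt0 //; lra.
(* By [green_le], this bounds every Green function on the support of the cutoff, where |x| + |y| <=
   2n. *)
pose B := G + n.*2%:R * (1 + 28 * G).
have B0 : 0 <= B by rewrite addr_ge0 // mulr_ge0 //; lra.
(* N / 2 must exceed B times the (2n + 1)^2 sites of that support. *)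
pose N := (Num.truncn (2 * (n.*2.+1%:R ^+ 2 * B))).+1.
have NB : 2 * (n.*2.+1%:R ^+ 2 * B) < N%:R by exact: truncnS_gt.
pose K := (n + N).+2.+3.
pose phi := cutoff R n.
have hit l : (l < N)%N ->
    2^-1 <= box_sum K (fun x y => phi x y * hit_prob R f l x y).
  move=> lN; pose m := (n + N)%N.
  have su : supported m (green R f l).
    by apply: (supportedW (n := l)); [rewrite /m; lia|exact: supported_green].
  have sp : supported m phi.
    by apply: (supportedW (n := n)); [rewrite /m; lia|exact: supported_cutoff].
  have form := box_sum_avg_form_le f_sign FS FC C1 t0 su sp (ltnSn m.+4).
  rewrite -/K in form.
  (* As phi(0) = 1, the form is 1 - <phi, A^l delta_0>; the two quarters [e1] and [e2] leave at
     least 1/2 for the pairing. *)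
  have e0 : box_sum K (fun x y => phi x y *
        (green R f l x y - avg f (green R f l) x y)) =
      1 - box_sum K (fun x y => phi x y * hit_prob R f l x y).
    under eq_box_sum do rewrite green_sub_avg mulrBr.
    by rewrite box_sumB box_sum_delta0 /phi cutoff00 ?gt_eqF.
  rewrite e0 in form.
  have lK : (l.+3 < K)%N by rewrite /K; lia.
  have e1 : C * (t * energy K (green R f l)) <= 4^-1.
    apply: (@le_trans _ _ (C * (t * (28 * (G + 1))))).
      rewrite ler_pM2l // ler_pM2l //.
      by have := energy_green_le R f_sign lK; have := gG l; lra.
    have -> : C * (t * (28 * (G + 1))) = 4^-1 * (112 * C * (G + 1) * t) by field.
    by rewrite tE mulr1.
  have e2 : C * (t^-1 * energy K phi) <= 4^-1.
    apply: (@le_trans _ _ (C * (t^-1 * (8 / harmonic_sum R n)))).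
      by rewrite ler_pM2l // ler_pM2l ?invr_gt0 // energy_cutoff_le.
    have -> : C * (t^-1 * (8 / harmonic_sum R n)) =
              (8 * C * t^-1) / harmonic_sum R n by ring.
    by rewrite ler_pdivrMr //; lra.
  by move: form; rewrite mulrDr; lra.
have low : N%:R * 2^-1 <= box_sum K (fun x y => phi x y * green R f N x y).
  rewrite (eq_box_sum K (h :=
    fun x y => \sum_(0 <= l < N) phi x y * hit_prob R f l x y)).
    rewrite box_sum_sum -[N in N%:R]subn0 mulr_natl -sumr_const_nat.
    by rewrite big_nat [leRHS]big_nat; apply: ler_sum => l /andP[_]; exact: hit.
  by move=> x y; rewrite mulr_sumr.
have up : box_sum K (fun x y => phi x y * green R f N x y) <= n.*2.+1%:R ^+ 2 * B.
  apply: (@le_trans _ _ (box_sum K (fun x y =>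
      B * ((`|x| <= n)%N%:R * (`|y| <= n)%N%:R)))).
    apply: ler_box_sum => x y.
    have [xy|xy] := boolP ((`|x| <= n) && (`|y| <= n))%N; last first.
      by rewrite /phi supported_cutoff ?mul0r ?mulr_ge0 //; lia.
    have [-> ->] := andP xy; rewrite !mulr1 -[B]mul1r.
    apply: ler_pM; rewrite ?cutoff_ge0 ?cutoff_le1 ?green_ge0 //.
    apply: (le_trans (green_le R f_sign N x y)).
    have g0 := green_ge0 R f N 0 0; have gN := gG N.
    rewrite /B; apply: lerD => //; apply: ler_pM => //; try lra.
    by rewrite ler_nat; lia.
  rewrite box_sumZ mulrC ler_wpM2r // /box_sum.
  under eq_bigr do rewrite -mulr_sumr.
  rewrite -mulr_suml expr2.
  by apply: ler_pM; rewrite ?sum_zrange_cutoff // sumr_ge0.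
by lra.
Qed.

(** * The random walk *)

Definition prefix_event (T : Type) (M : nat -> T -> vertex) (m : nat)
    (x : nat -> vertex) : set T :=
  [set w | forall i : nat, (i <= m)%N -> M i w = x i].

Lemma deleted_vertical_even x y : deleted_vertical x y -> even_site x y.
Proof. by rewrite /even_site => -[j [k [[-> ->]|[-> ->]]]]; lia. Qed.

Lemma honeycomb_arc_horizontal f (u : vertex) :
  f u.2 = 1 \/ f u.2 = -1 -> honeycomb_arc f u (u.1 + f u.2, u.2).
Proof. by move=> fu; left; split => //=; case: fu => ->; [left|right]. Qed.

Lemma honeycomb_arc_vertical f (u : vertex) :
  honeycomb_arc f u (u.1, vert_step u.1 u.2).
Proof.
right; split => //=; rewrite /vert_step; case: ifP => e; [right|left];
  split; rewrite ?subrK // => /deleted_vertical_even; last by rewrite e.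
by move: e; rewrite /even_site; lia.
Qed.

Section RandomWalk.
Variables (R : realType) (f : int -> int).
Hypothesis f_sign : forall k : int, f k = 1 \/ f k = -1.
Variables (d : measure_display) (T : measurableType d) (P : probability T R).
Variable M : nat -> T -> vertex.
Hypothesis M_walk : simple_random_walk P f M.

Lemma measurable_prefix_event m x : measurable (prefix_event M m x).
Proof.
have [mM _ _] := M_walk.
have -> : prefix_event M m x =
    \bigcap_(i in `I_m.+1) [set w | M i w = x i].
  by apply/seteqP; split => w h i im; exact: h.
by apply: bigcap_measurable => [|i _]; [exists 0%N|exact: mM].
Qed.

(** Conditioning on the next step amounts to lengthening the prefix, hence the induction over all
    prefixes. A lower bound suffices to make the series diverge, and it follows from the two arcs
    exhibited above. *)
Lemma hit_prob_prefix_le l m x :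
  (P (prefix_event M m x) * (hit_prob R f l (x m).1 (x m).2)%:E <=
   P (prefix_event M m x `&` [set w | M (m + l)%N w = origin]))%E.
Proof.
have [mM _ markov] := M_walk.
elim: l m x => [|l IH] m x.
  rewrite addn0 /= /delta0; case xm: (x m) => [a b] /=.
  have [a0|] := eqVneq a 0; last by rewrite mule0 measure_ge0.
  have [b0|] := eqVneq b 0; last by rewrite mule0 measure_ge0.
  rewrite mule1 le_eqVlt; apply/orP; left; apply/eqP; congr (P _).
  apply/seteqP; split => [w h|w []//]; split => //=.
  by rewrite h // xm; congr pair.
set u := x m.
pose ext v (i : nat) := if (i <= m)%N then x i else v.
have extm v : ext v m.+1 = v by rewrite /ext ltnn.
have extx v : ext v m = u by rewrite /ext leqnn.
have ext_prefix v : honeycomb_arc f u v ->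
    P (prefix_event M m.+1 (ext v)) = (P (prefix_event M m x) * (2^-1)%:E)%E.
  move=> uv; rewrite /prefix_event markov extm extx /step_prob asboolT //.
  congr (P _ * _)%E; apply/seteqP; split => w h i im; rewrite h // /ext im //.
pose A v := prefix_event M m.+1 (ext v) `&` [set w | M (m.+1 + l)%N w = origin].
have mA v : measurable (A v).
  by apply: measurableI => //; exact: measurable_prefix_event.
set h := (u.1 + f u.2, u.2); set v := (u.1, vert_step u.1 u.2).
have ph := ext_prefix h (honeycomb_arc_horizontal (f_sign _)).
have pv := ext_prefix v (honeycomb_arc_vertical f u).
(* Distinct endpoints make the two continuations disjoint, so their probabilities add up. *)
have hv : h <> v.
  by move=> [/eqP]; have := f_sign u.2; lia.
have AhAv : A h `&` A v = set0.
  apply/seteqP; split => // w [[/(_ m.+1 (leqnn _)) + _] [/(_ m.+1 (leqnn _)) + _]].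
  by rewrite !extm => ->.
apply: (@le_trans _ _ (P (A h `|` A v))); last first.
  apply: le_measure; rewrite ?inE.
  - exact: measurableU.
  - by apply: measurableI => //; exact: measurable_prefix_event.
  - have sub z : A z `<=` prefix_event M m x `&` [set w | M (m + l.+1)%N w = origin].
      move=> w [pw]; rewrite /= addSnnS => ow; split => // i im.
      by rewrite pw ?leqW // /ext im.
    by rewrite subUset; split; exact: sub.
rewrite measureU //; apply: le_trans (leeD (IH m.+1 (ext h)) (IH m.+1 (ext v))).
rewrite !extm ph pv -!muleA -!EFinM -ge0_muleDr ?lee_fin ?mulr_ge0
  ?hit_prob_ge0 ?invr_ge0 //.
by rewrite -EFinD -mulrDr.
Qed.

Lemma hit_prob_le l : ((hit_prob R f l 0 0)%:E <= P [set w | M l w = origin])%E.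
Proof.
have [mM M0 _] := M_walk.
have := hit_prob_prefix_le l 0 (fun=> origin).
have -> : prefix_event M 0 (fun=> origin) = [set w | M 0%N w = origin].
  apply/seteqP; split => w h; first exact: h.
  by move=> i; rewrite leqn0 => /eqP ->.
rewrite M0 mul1e => /le_trans; apply; apply: le_measure; rewrite ?inE //.
by apply: measurableI.
Qed.

End RandomWalk.

Theorem theorem1p2 (R : realType) (Q : nat) (f : int -> int)
    (Q_gt1 : (1 < Q)%N) (Q_even : ~~ odd Q)
    (f_sign : forall k : int, f k = 1 \/ f k = -1)
    (f_periodic : forall k : int, f (k + Q%:Z) = f k)
    (f_sum0 : \sum_(0 <= k < Q) f k%:Z = 0)
    (d : measure_display) (T : measurableType d) (P : probability T R)
    (M : nat -> T -> vertex)
    (M_walk : simple_random_walk P f M) :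
  recurrent P M.
Proof.
have [F [C [FS FC C1]]] := @bounded_primitive R Q f (ltnW Q_gt1) f_periodic f_sum0.
rewrite /recurrent; set S := (\sum_(0 <= l <oo) _)%E.
have part N : ((green R f N 0 0)%:E <= S)%E.
  apply: le_trans (nneseries_lim_ge N _); last by move=> *; exact: measure_ge0.
  rewrite /green -sumEFin; apply: lee_sum => l _.
  exact: (hit_prob_le f_sign M_walk).
(* A finite value s would bound the Green function at the origin for all N; the empty partial sum
   excludes -oo. *)
case: S part => [s| |] part //; last by have := part 0%N.
have [N] := green_unbounded f_sign FS FC C1 s.
by rewrite ltNge -lee_fin part.
Qed.
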